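(* Let $n,k \geq 2$ be integers and let $\Gamma$ be a $(p,\lambda)$-pseudo-random graph with $N$ vertices, where $0<p \leq 1/2$ and $\lambda \leq (k/p)^{-100n^3k}N$. Then for every coloring of the edges of $\Gamma$ with $k$ colors, every graph on $n$ vertices has a monochromatic induced copy in $\Gamma$. Moreover, all of these monochromatic induced copies (one for each graph on $n$ vertices) can be found in the same color.
   Context: For subsets $A,B$ of the vertex set of a graph, $d(A,B)$ denotes the fraction of ordered pairs $(a,b)\in A\times B$ that are edges. A graph $\Gamma=(V,E)$ is $(p,\lambda)$-pseudo-random if $|d(A,B)-p| \leq \lambda/\sqrt{|A||B|}$ for all nonempty (not necessarily disjoint) subsets $A,B \subset V$. A monochromatic induced copy of a graph $F$ in an edge-colored $\Gamma$ is an induced subgraph of $\Gamma$ isomorphic to $F$ all of whose edges have the same color. *)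

(* Defs.v *)
From HB Require Import structures.
From mathcomp Require Import all_boot all_order all_algebra.
From mathcomp Require Import reals.

Set Implicit Arguments.
Unset Strict Implicit.
Unset Printing Implicit Defensive.

Import Order.TTheory GRing.Theory Num.Theory.
Local Open Scope ring_scope.

Record sgraph (V : finType) := SGraph {
  adj : rel V;
  adj_sym : symmetric adj;
  adj_irrefl : irreflexive adj
}.

Section Induced.
Variables (V : finType) (G : sgraph V) (S : {set V}).

Definition induced_adj : rel {x : V | x \in S} :=
  fun x y => adj G (val x) (val y).

Lemma induced_adj_sym : symmetric induced_adj.
Proof. by move=> x y; apply: adj_sym. Qed.

Lemma induced_adj_irrefl : irreflexive induced_adj.
Proof. by move=> x; apply: adj_irrefl. Qed.

Definition induced : sgraph {x : V | x \in S} :=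
  SGraph induced_adj_sym induced_adj_irrefl.
End Induced.

Definition isomorphic (U V : finType) (F : sgraph U) (G : sgraph V) : Prop :=
  exists2 f : U -> V, bijective f &
    forall x y, adj G (f x) (f y) = adj F x y.

Definition density (R : realType) (V : finType) (G : sgraph V)
    (A B : {set V}) : R :=
  #|[set ab in setX A B | adj G ab.1 ab.2]|%:R / (#|A| * #|B|)%N%:R.

Definition pseudo_random (R : realType) (V : finType) (G : sgraph V)
    (p lambda : R) : Prop :=
  forall A B : {set V}, A != set0 -> B != set0 ->
    `|density R G A B - p| <= lambda / Num.sqrt (#|A| * #|B|)%N%:R.

(* A colouring assigns a colour to every set of vertices; only its values on
   the two-element sets [set x; y] with x and y adjacent are ever used. *)
Definition mono_induced_copy (U V : finType) (k : nat) (F : sgraph U)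
    (G : sgraph V) (c : {set V} -> 'I_k) (i : 'I_k) : Prop :=
  exists S : {set V},
    isomorphic F (induced G S) /\
    (forall x y, x \in S -> y \in S -> adj G x y -> c [set x; y] = i).

(* Main.v *)
(** Dependent random choice. Put [z = p / k]. In a large vertex set [A] some
    colour [i] has density at least of order [z]; the set [A'] of those vertices of [A]
    that are joined in colour [i] to all entries of a random [2n]-tuple [T] of [A]
    is then large on average, while an [m]-tuple with few common [i]-neighbours
    in [A] survives in [A'] only if [T] falls in this small common
    neighbourhood, so few such tuples survive. Repeating this [k n] times gives
    a chain of sets, and some colour [i] is used at [n] of its levels. Along
    these levels a graph [F] on [n] vertices is embedded from the deepest level
    upwards: the number of partial induced copies in colour [i] remains larger
    than the number of exceptional tuples, because a typical tuple has many
    common [i]-neighbours for the edges of [F], and pseudo-randomness of the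
    whole graph makes almost every vertex non-adjacent to at least a quarter of
    a large set. The thresholds are powers of [z], and the deepest level
    dominates the exponents. Since the graph to embed may be chosen
    separately for each colour, a counterexample for every colour at once is
    excluded, which gives a single colour for all graphs. *)
Require Import Defs.
From HB Require Import structures.
From mathcomp Require Import all_boot all_order all_algebra.
From mathcomp Require Import reals.
From mathcomp Require Import zify ring lra.

Set Implicit Arguments.
Unset Strict Implicit.
Unset Printing Implicit Defensive.

Import Order.TTheory GRing.Theory Num.Theory.
Local Open Scope ring_scope.

(** * Sums over tuples taken from a product of sets *)

Section TupleSums.
Variables (R : realFieldType) (V : finType).
Implicit Types (A : {set V}) (As : seq {set V}) (f g : seq V -> R) (w : seq V).

(* The lists [w] have one entry in each set of [As], in the same order. *)
Fixpoint tsum As f : R :=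
  if As is A :: As' then tsum As' (fun w => \sum_(x in A) f (x :: w))
  else f [::].

Definition inside As w := all2 (fun x A => x \in A) w As.

Definition volume As : R := \prod_(A <- As) #|A|%:R.

Lemma inside_size As w : inside As w -> size w = size As.
Proof. by elim: As w => [|A As IH] [|x w] //= /andP[_ /IH ->]. Qed.

Lemma inside_nseq m A w : inside (nseq m A) w -> all (mem A) w.
Proof. by elim: m w => [|m IH] [|x w] //= /andP[-> /IH ->]. Qed.

Lemma tsum_le As f g :
  (forall w, inside As w -> f w <= g w) -> tsum As f <= tsum As g.
Proof.
elim: As f g => [|A As IH] f g fg /=; first exact: fg.
by apply: IH => w wAs; apply: ler_sum => x xA; apply: fg; rewrite /= xA.
Qed.

Lemma eq_tsum As f g :
  (forall w, inside As w -> f w = g w) -> tsum As f = tsum As g.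
Proof.
move=> fg; apply: le_anti; apply/andP.
by split; apply: tsum_le => w /fg ->.
Qed.

Lemma tsum_sum (I : finType) (P : pred I) As (F : I -> seq V -> R) :
  tsum As (fun w => \sum_(i | P i) F i w) = \sum_(i | P i) tsum As (F i).
Proof.
elim: As F => [|A As IH] F //=; rewrite -IH.
by apply: eq_tsum => w _; rewrite exchange_big.
Qed.

Lemma tsumD As f g : tsum As (fun w => f w + g w) = tsum As f + tsum As g.
Proof.
elim: As f g => [|A As IH] f g //=; rewrite -IH.
by apply: eq_tsum => w _; rewrite big_split.
Qed.

Lemma tsumZ As c f : tsum As (fun w => c * f w) = c * tsum As f.
Proof.
elim: As f => [|A As IH] f //=; rewrite -IH.
by apply: eq_tsum => w _; rewrite mulr_sumr.
Qed.

Lemma tsumB As f g : tsum As (fun w => f w - g w) = tsum As f - tsum As g.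
Proof.
rewrite -[- tsum As g]mulN1r -tsumZ -tsumD.
by apply: eq_tsum => w _; rewrite mulN1r.
Qed.

Lemma tsum_const As c : tsum As (fun=> c) = c * volume As.
Proof.
elim: As c => [|A As IH] c /=; first by rewrite /volume big_nil mulr1.
by rewrite IH sumr_const /volume big_cons mulrA mulr_natr.
Qed.

Lemma tsum_ge0 As f : (forall w, 0 <= f w) -> 0 <= tsum As f.
Proof.
move=> f0; apply: (le_trans (y := tsum As (fun=> 0))).
  by rewrite tsum_const mul0r.
by apply: tsum_le => w _; apply: f0.
Qed.

Lemma volume_nseq m A : volume (nseq m A) = #|A|%:R ^+ m.
Proof. by rewrite /volume big_nseq -Monoid.iteropE. Qed.

Lemma volume_ge0 As : 0 <= volume As.
Proof. by apply: prodr_ge0. Qed.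

Lemma tsum_exchange As Bs (F : seq V -> seq V -> R) :
  tsum As (fun w => tsum Bs (F w)) = tsum Bs (fun u => tsum As (F^~ u)).
Proof.
elim: As F => [|A As IH] F //=.
by rewrite -IH; apply: eq_tsum => w _; rewrite tsum_sum.
Qed.

Lemma tsum_subset As Bs f : (forall w, 0 <= f w) ->
  all2 (fun A B : {set V} => A \subset B) As Bs -> tsum As f <= tsum Bs f.
Proof.
elim: As Bs f => [|A As IH] [|B Bs] f f0 //= /andP[AB AsBs].
apply: (le_trans (y := tsum As (fun w => \sum_(x in B) f (x :: w)))).
  apply: tsum_le => w _; rewrite [leRHS](big_setID A) /= (setIidPr AB).
  by rewrite lerDl sumr_ge0.
by apply: IH => // w; rewrite sumr_ge0.
Qed.

(** Moving the restriction to [B] into an indicator weight allows two sums to be exchanged when [B]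
    depends on the other summation variable. *)
Lemma tsum_nseq_sub m (A B : {set V}) f : B \subset A ->
  tsum (nseq m B) f = tsum (nseq m A) (fun w => (all (mem B) w)%:R * f w).
Proof.
move=> BA; elim: m f => [|m IH] f /=; first by rewrite mul1r.
rewrite IH; apply: eq_tsum => w _; rewrite mulr_sumr [RHS](big_setID B) /=.
rewrite (setIidPr BA) [X in _ = _ + X]big1 ?addr0.
  by apply: eq_bigr => x ->.
by move=> x /setDP[_ /negPf ->]; rewrite mul0r.
Qed.

Lemma tsum_all m A (P : pred V) :
  tsum (nseq m A) (fun w => (all P w)%:R) = #|[set y in A | P y]|%:R ^+ m.
Proof.
rewrite -volume_nseq -[RHS]mul1r -tsum_const [RHS](tsum_nseq_sub _ _ (A := A)).
  apply: eq_tsum => w /inside_nseq /allP wA; rewrite mulr1; congr (_ %:R).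
  by congr nat_of_bool; apply: eq_in_all => x /wA /= xA; rewrite inE xA.
by apply/subsetP => x; rewrite inE => /andP[].
Qed.

(** The first-moment principle, proved one coordinate at a time. It supplies both the random tuple
    of dependent random choice and the final embedding. *)
Lemma tsum_exists As f c : c * volume As < tsum As f ->
  exists2 w, inside As w & c < f w.
Proof.
elim: As f c => [|A As IH] f c /=.
  by rewrite /volume big_nil mulr1; exists [::].
rewrite /volume big_cons mulrA => /IH[w wAs]; rewrite mulr_natr -sumr_const.
case: (pickP [pred x in A | c < f (x :: w)]) => [x /= /andP[xA cf] _|none].
  by exists (x :: w); rewrite //= xA.
rewrite ltNge ler_sum // => x xA.
by have := none x; rewrite /= xA /= => /negbT; rewrite -leNgt.
Qed.
End TupleSums.

(** * Candidates for the next vertex of a partial induced copy *)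

Section Patterns.
Variables (R : realFieldType) (V : finType) (col non : rel V).
Implicit Types (A D E : {set V}) (As : seq {set V}) (w : seq V).

(* [w] lists embedded vertices, the latest first, so that the vertex number [j]
   is the head [y] of the suffix [y :: w'] with [size w' = j]; [row j] tells
   whether [x] must be joined to it. *)
Fixpoint fits (row : nat -> bool) (x : V) w :=
  if w is y :: w' then
    (if row (size w') then col x y else non x y) && fits row x w'
  else true.

(** The relaxation of [fits] that dependent random choice can control; the non-adjacencies are
    recovered afterwards from pseudo-randomness. *)
Fixpoint fits_edges (row : nat -> bool) (x : V) w :=
  if w is y :: w' then (row (size w') ==> col x y) && fits_edges row x w'
  else true.

Definition cand row D w := [set x in D | fits row x w].
Definition cand_edges row D w := [set x in D | fits_edges row x w].

Lemma fits_edges_all row x w : all (col^~ x) w -> symmetric col ->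
  fits_edges row x w.
Proof.
by move=> + sc; elim: w => [|y w IH] //= /andP[yx /IH ->]; rewrite sc yx implybT.
Qed.

(* Every vertex list counted here contains a vertex [x] at a place prescribed to
   be a non-neighbour which spoils the candidate set left by the other
   vertices, and this set does not depend on [x]. *)
Lemma few_small_cand (s kap : R) M row As D :
  (forall A E, A \in As -> s / 4 ^+ M <= #|E|%:R ->
     #|[set x in A | #|[set y in E | non y x]|%:R < #|E|%:R / 4 :> R]|%:R
       <= kap * #|A|%:R) ->
  (size As <= M)%N -> 0 <= s -> 0 <= kap ->
  tsum As (fun w => ((s <= #|cand_edges row D w|%:R) &&
                     (#|cand row D w|%:R < s / 4 ^+ size w))%:R)
    <= (size As)%:R * kap * volume R As.
Proof.
move=> + + s0 k0; elim: As D => [|A As IH] D few sM /=.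
  rewrite /cand /cand_edges /= expr0 divr1 !mul0r.
  by case: (leP s).
have {}IH D' := IH D' (fun B E hB => few B E (mem_behead (s := A :: As) hB)) (ltnW sM).
have volE : volume R (A :: As) = #|A|%:R * volume R As.
  by rewrite /volume big_cons.
have vol0 := volume_ge0 R As.
have four m : s / 4 ^+ m.+1 <= s / 4 ^+ m.
  apply: ler_wpM2l => //; rewrite lef_pV2 ?posrE ?exprn_gt0 //.
  by rewrite exprS ler_peMl ?exprn_ge0 // ler1n.
case rowE : (row (size As)).
  pose D_ x := [set z in D | col z x].
  apply: (le_trans (y := tsum As (fun w => \sum_(x in A)
     ((s <= #|cand_edges row (D_ x) w|%:R) &&
      (#|cand row (D_ x) w|%:R < s / 4 ^+ size w))%:R))).
    apply: tsum_le => w /inside_size sw; apply: ler_sum => x xA.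
    have -> : cand_edges row D (x :: w) = cand_edges row (D_ x) w.
      by apply/setP => z; rewrite !inE /= sw rowE /= andbA.
    have -> : cand row D (x :: w) = cand row (D_ x) w.
      by apply/setP => z; rewrite !inE /= sw rowE /= andbA.
    rewrite ler_nat; case: (s <= _) => //=.
    by case: ltP => // lt1; rewrite (lt_le_trans lt1 (four _)).
  rewrite tsum_sum; apply: (le_trans (y := \sum_(x in A) (size As)%:R * kap * volume R As)).
    by apply: ler_sum => x _; apply: IH.
  rewrite sumr_const volE -mulr_natr -natr1.
  have := mulr_ge0 (mulr_ge0 k0 (ler0n R #|A|)) vol0; lra.
(* Now [x] must be a non-neighbour. Either [w] is bad already, which [g] counts for all [x], or its
   candidate set is large and few [x] cut it below a quarter. *)
pose g w : R := ((s <= #|cand_edges row D w|%:R) &&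
                     (#|cand row D w|%:R < s / 4 ^+ size w))%:R.
apply: (le_trans (y := tsum As (fun w => #|A|%:R * g w + kap * #|A|%:R))).
  apply: tsum_le => w wAs; have sw := inside_size wAs.
  have E1 x : cand_edges row D (x :: w) = cand_edges row D w.
    by apply/setP => z; rewrite !inE /= sw rowE.
  have E2 x : cand row D (x :: w) = [set y in cand row D w | non y x].
    by apply/setP => z; rewrite !inE /= sw rowE -andbA [non _ _ && _]andbC.
  rewrite /g; case: (leP s _) => big; last first.
    rewrite big1 => [|x _]; last by rewrite E1 leNgt big.
    by rewrite mulr0 add0r mulr_ge0.
  rewrite /=; case: ltP => small.
    rewrite mulr1 ler_wpDr ?mulr_ge0 // -sumr_const.
    by apply: ler_sum => x _; rewrite lern1 leq_b1.
  rewrite mulr0 add0r.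
  apply: (le_trans _ (few A (cand row D w) (mem_head _ _) _)); last first.
    apply: le_trans small; apply: ler_wpM2l => //.
    rewrite lef_pV2 ?posrE ?exprn_gt0 // ler_weXn2l ?ler1n //.
    by rewrite sw ltnW.
  rewrite -sum1_card natr_sum.
  rewrite [leRHS](eq_bigl (fun x => (x \in A) && (#|[set y in cand row D w | non y x]|%:R < #|cand row D w|%:R / 4 :> R))); last by move=> x; rewrite inE.
  rewrite [leRHS]big_mkcondr /=; apply: ler_sum => x xA.
  rewrite E1 E2; case: (ltP _ (s / _)) => lt1; last by rewrite andbF; case: ifP.
  rewrite ifT ?lern1 ?leq_b1 //; apply: (lt_le_trans lt1).
  rewrite ler_pdivlMr //; apply: le_trans small; rewrite /= exprS.
  by rewrite invfM mulrC mulrCA mulVKf ?pnatr_eq0.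
rewrite tsumD tsumZ tsum_const volE.
have := ler_wpM2l (ler0n R #|A|) (IH D); rewrite -/g -natr1 => h.
apply: (le_trans (lerD h (lexx _))); lra.
Qed.

End Patterns.

(** * Dependent random choice in the densest colour *)

Section DependentRandomChoice.
Variables (R : realFieldType) (V : finType).
Implicit Types (A : {set V}) (w T : seq V).

Lemma card_all_sum (r : rel V) A T :
  #|[set x in A | all (r x) T]|%:R = \sum_(x in A) (all (r x) T)%:R :> R.
Proof.
rewrite -sum1_card natr_sum.
rewrite [LHS](eq_bigl (fun x => (x \in A) && all (r x) T)); last first.
  by move=> x; rewrite inE.
by rewrite big_mkcondr /=; apply: eq_bigr => x _; case: all.
Qed.

(** A cheap substitute for Jensen's inequality: giving up half of the average makes a linear lower
    bound for the power sufficient. *)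
Lemma sum_pow_ge (I : finType) (A : {set I}) (d : I -> R) (th : R) t :
  0 <= th -> (forall x, 0 <= d x) -> (0 < t)%N ->
  2 * th * #|A|%:R <= \sum_(x in A) d x ->
  th ^+ t * #|A|%:R <= \sum_(x in A) d x ^+ t.
Proof.
case: t => // t th0 d0 _ avg.
(* [d ^+ t.+1 >= th ^+ t * (d - th)] holds trivially when [d < th]. *)
apply: (le_trans (y := \sum_(x in A) th ^+ t * (d x - th))).
  rewrite -mulr_sumr exprSr -mulrA ler_wpM2l ?exprn_ge0 //.
  by rewrite big_split /= sumrN sumr_const -mulr_natr; lra.
apply: ler_sum => x _; case: (leP th (d x)) => thd.
  rewrite exprSr; apply: (le_trans (y := th ^+ t * d x)).
    by rewrite ler_wpM2l ?exprn_ge0 //; lra.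
  by apply: ler_wpM2r => //; rewrite lerXn2r ?nnegrE.
apply: (le_trans (y := 0)); last by rewrite exprn_ge0.
by rewrite mulr_ge0_le0 ?exprn_ge0 //; lra.
Qed.

(** The colour is selected inside the argument, so the rows are given for every colour. One tuple
    has to work for all lengths [m] at once, hence a single objective function is averaged. *)
Lemma dependent_random_choice k (col : 'I_k -> rel V) A (q tau beta : R) n t
    (rows : 'I_k -> nat -> nat -> bool) :
  (forall i, symmetric (col i)) -> (0 < #|A|)%N -> (0 < k)%N -> (0 < t)%N ->
  0 < q -> 0 <= tau -> 0 < beta ->
  2 * n%:R * tau ^+ t <= beta * q ^+ t ->
  k%:R * (2 * q * #|A|%:R * #|A|%:R) <=
    \sum_(i < k) \sum_(x in A) #|[set y in A | col i x y]|%:R ->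
  exists i, exists A' : {set V}, [/\ A' \subset A,
    q ^+ t / 4 * #|A|%:R <= #|A'|%:R &
    forall m, (m < n)%N ->
      tsum (nseq m A') (fun w =>
        (#|cand_edges (col i) (rows i m) A w|%:R < tau * #|A|%:R)%R%:R)
      <= beta * #|A|%:R ^+ m].
Proof.
move=> csym A0 k0 t0 q0 tau0 beta0 hbeta dens; set a : R := #|A|%:R in hbeta dens *.
have a0 : 0 < a by rewrite ltr0n.
have [i densi] : exists i,
    2 * q * a * a <= \sum_(x in A) #|[set y in A | col i x y]|%:R.
  case: (pickP (fun i => 2 * q * a * a <= \sum_(x in A) #|[set y in A | col i x y]|%:R)).
    by move=> i ?; exists i.
  move=> none; move: dens; rewrite leNgt; case/negP.
  apply: (lt_le_trans (y := \sum_(i < k) 2 * q * a * a)); last first.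
    by rewrite sumr_const card_ord -[_ *+ k]mulr_natl.
  apply: ltr_sum => [|i _]; first by apply/hasP; exists (Ordinal k0); rewrite ?mem_index_enum.
  by rewrite ltNge none.
pose AT T := [set x in A | all (col i x) T].
pose bad m w : R := (#|cand_edges (col i) (rows i m) A w|%:R < tau * a)%R%:R.
(* The relative size of [AT T] is at most 1, so a positive value of [f] keeps every single penalty
   below 1, which is the required bound for that length. *)
pose f T := a^-1 * #|AT T|%:R -
  \sum_(m < n) (beta * a ^+ m)^-1 * tsum (nseq m (AT T)) (bad m).
have bam0 m : 0 < beta * a ^+ m by rewrite mulr_gt0 ?exprn_gt0.
(* Double counting: a vertex [x] lies in [AT T] exactly when [T] lies in its neighbourhood, so this
   is a sum of [t]-th powers of degrees. *)
have sumAT : a * (q * a) ^+ t <= tsum (nseq t A) (fun T => #|AT T|%:R).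
  rewrite (eq_tsum (g := fun T => \sum_(x in A) (all (col i x) T)%:R)); last first.
    by move=> T _; apply: card_all_sum.
  rewrite tsum_sum (eq_bigr (fun x => #|[set y in A | col i x y]|%:R ^+ t)).
    rewrite [leLHS]mulrC; apply: sum_pow_ge => //; first by rewrite mulr_ge0 ?ltW.
    by apply: le_trans densi; rewrite -/a; lra.
  by move=> x _; rewrite tsum_all.
(* If [w] lies in [AT T], each entry of [T] is joined to all of [w] and so fits any row; for a bad
   [w] this leaves fewer than [tau * a] choices per entry of [T]. *)
have sumbad m : tsum (nseq t A) (fun T => tsum (nseq m (AT T)) (bad m))
    <= a ^+ m * (tau * a) ^+ t.
  rewrite (eq_tsum (g := fun T => tsum (nseq m A)
      (fun w => (all (mem (AT T)) w)%:R * bad m w))); last first.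
    move=> T _; apply: tsum_nseq_sub; apply/subsetP => x.
    by rewrite inE => /andP[].
  rewrite tsum_exchange.
  apply: (le_trans (y := tsum (nseq m A) (fun=> (tau * a) ^+ t))); last first.
    by rewrite tsum_const volume_nseq mulrC.
  apply: tsum_le => w wA.
  apply: (le_trans (y := tsum (nseq t A) (fun T => bad m w *
      (all (fun y => fits_edges (col i) (rows i m) y w) T)%:R))).
    apply: tsum_le => T TA; rewrite mulrC ler_wpM2l ?ler0n // ler_nat.
    case: (boolP (all (mem (AT T)) w)) => //= /allP wAT.
    rewrite lt0b; apply/allP => y yT; apply: fits_edges_all (csym i).
    by apply/allP => x /wAT /=; rewrite inE => /andP[_ /allP/(_ _ yT)].
  rewrite tsumZ tsum_all /bad.
  case: ltP => [small|_]; last by rewrite mul0r exprn_ge0 // mulr_ge0 // ltW.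
  by rewrite mul1r lerXn2r ?nnegrE ?(ltW small) // mulr_ge0 // ltW.
have sumf : q ^+ t / 2 * volume R (nseq t A) <= tsum (nseq t A) f.
  rewrite tsumB tsumZ tsum_sum volume_nseq -/a.
  have h1 : (q * a) ^+ t <= a^-1 * tsum (nseq t A) (fun T => #|AT T|%:R).
    by rewrite ler_pdivlMl.
  (* By [hbeta] each of the [n] lengths costs at most a share [1 / n] of half the gain. *)
  have h2 : \sum_(m < n) tsum (nseq t A) (fun T =>
      (beta * a ^+ m)^-1 * tsum (nseq m (AT T)) (bad m)) <=
      \sum_(m < n) q ^+ t / (2 * n%:R) * a ^+ t.
    apply: ler_sum => m _; rewrite tsumZ ler_pdivrMl //.
    apply: (le_trans (sumbad m)).
    have n0 : (0 < n)%N by apply: leq_ltn_trans (ltn_ord m).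
    have -> : a ^+ m * (tau * a) ^+ t = tau ^+ t * (a ^+ m * a ^+ t).
      by rewrite exprMn; ring.
    have -> : beta * a ^+ m * (q ^+ t / (2 * n%:R) * a ^+ t) =
        beta * q ^+ t / (2 * n%:R) * (a ^+ m * a ^+ t) by ring.
    apply: ler_wpM2r; first by rewrite mulr_ge0 ?exprn_ge0 ?ltW.
    by rewrite ler_pdivlMr ?mulr_gt0 ?ltr0n // mulrC.
  rewrite sumr_const card_ord -[_ *+ n]mulr_natl in h2.
  have h3 : n%:R * (q ^+ t / (2 * n%:R) * a ^+ t) <= q ^+ t / 2 * a ^+ t.
    case: (posnP n) => [->|n0]; first by rewrite mul0r mulr_ge0 ?divr_ge0 ?exprn_ge0 ?ltW.
    have nR : n%:R != 0 :> R by rewrite pnatr_eq0 -lt0n.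
    by rewrite invfM le_eqVlt; apply/orP; left; apply/eqP; field.
  rewrite exprMn in h1; have := le_trans h2 h3; lra.
have [T TA fT] : exists2 T, inside (nseq t A) T & q ^+ t / 4 < f T.
  apply: tsum_exists; apply: lt_le_trans sumf.
  rewrite ltr_pM2r ?volume_nseq ?exprn_gt0 //.
  by have := exprn_gt0 t q0; lra.
have term0 m : 0 <= (beta * a ^+ m)^-1 * tsum (nseq m (AT T)) (bad m).
  apply: mulr_ge0; first by rewrite invr_ge0 ltW.
  by apply: tsum_ge0 => w; apply: ler0n.
have sub : AT T \subset A by apply/subsetP => x; rewrite inE => /andP[].
exists i, (AT T); split=> //.
  rewrite -ler_pdivlMr // [leRHS]mulrC; apply: ltW; apply: (lt_le_trans fT).
  by rewrite /f gerBl sumr_ge0.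
move=> m mn; rewrite -[leRHS]mulr1 -ler_pdivrMl //.
have : a^-1 * #|AT T|%:R <= 1.
  by rewrite ler_pdivrMl // mulr1 ler_nat subset_leq_card.
move: fT; rewrite /f (bigD1 (Ordinal mn)) //=.
have := exprn_gt0 t q0.
have : 0 <= \sum_(i < n | i != Ordinal mn) (beta * a ^+ i)^-1 * tsum (nseq i (AT T)) (bad i) by apply: sumr_ge0.
rewrite -/(bad m); lra.
Qed.

End DependentRandomChoice.

(** * Counting partial induced copies along a chain of sets *)

Section Embedding.
Variables (R : realFieldType) (V : finType) (col non : rel V).
Variable e : nat -> nat -> bool.

(** Each vertex is tested against the earlier ones only, so just the entries [e l j] with [j < l]
    are read. *)
Fixpoint valid (w : seq V) :=
  if w is x :: w' then fits col non (e (size w')) x w' && valid w' else true.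

Fixpoint stack (B : nat -> {set V}) m :=
  if m is m'.+1 then B m' :: stack B m' else [::].

Lemma size_stack B m : size (stack B m) = m.
Proof. by elim: m => //= m ->. Qed.

Lemma mem_stack B m (A : {set V}) : A \in stack B m -> exists2 l, (l < m)%N & A = B l.
Proof.
elim: m => //= m IH; rewrite inE => /predU1P[->|/IH[l lm ->]]; first by exists m.
by exists l => //; apply: ltnW.
Qed.

Lemma volume_stack_ge (B : nat -> {set V}) m (g : R) : 0 <= g ->
  (forall l, (l < m)%N -> g <= #|B l|%:R) -> g ^+ m <= volume R (stack B m).
Proof.
move=> g0; elim: m => [|m IH] hB; rewrite /volume /= ?big_nil ?big_cons //.
rewrite exprS ler_pM ?exprn_ge0 //; first exact: hB.
by apply: IH => l lm; apply: hB; apply: ltnW.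
Qed.

(** Induction on the number of embedded vertices. The exceptional tuples of either kind make up at
    most a quarter of the guaranteed count, so half of it extends; this is the 2 in [sg / 2]. The
    factor [gam] converts powers of [#|B m|] into the product of the smaller sizes. *)
Lemma valid_exists (B : nat -> {set V}) n (tau gam beta kap : R) :
  0 < tau -> 0 <= gam -> 0 <= kap ->
  (forall m, (m < n)%N -> (0 < #|B m|)%N) ->
  (forall l m, (l < m < n)%N -> gam * #|B m|%:R <= #|B l|%:R) ->
  (forall m, (m < n)%N -> tsum (stack B m) (fun w =>
     (#|cand_edges col (e m) (B m) w|%:R < tau * #|B m|%:R)%R%:R)
       <= beta * #|B m|%:R ^+ m) ->
  (forall l m (E : {set V}), (l < m < n)%N -> tau * #|B m|%:R / 4 ^+ m <= #|E|%:R ->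
     #|[set x in B l | #|[set y in E | non y x]|%:R < #|E|%:R / 4 :> R]|%:R
       <= kap * #|B l|%:R) ->
  (forall m, (m < n)%N -> beta <= (tau / 4 ^+ n / 2) ^+ m * gam ^+ m / 4) ->
  (forall m, (m < n)%N -> m%:R * kap <= (tau / 4 ^+ n / 2) ^+ m / 4) ->
  exists2 w, size w = n & valid w.
Proof.
move=> tau0 gam0 kap0 B0 hgam hbad hnon hbeta hkap.
set sg := tau / 4 ^+ n in hbeta hkap.
have sg0 : 0 < sg by rewrite divr_gt0 ?exprn_gt0.
have count m : (m <= n)%N ->
    (sg / 2) ^+ m * volume R (stack B m) <=
    tsum (stack B m) (fun w => (valid w)%:R).
  elim: m => [|m IH] mn; first by rewrite /volume /= big_nil mulr1.
  have {}IH := IH (ltnW mn).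
  set b : R := #|B m|%:R; have b0 : 0 < b by rewrite ltr0n B0.
  have sb0 : 0 <= sg * b by rewrite mulr_ge0 ?ltW.
  have sgm0 : 0 <= (sg / 2) ^+ m.
    by apply: exprn_ge0; apply: divr_ge0 => //; apply: ltW.
  pose b1 w : R := (#|cand_edges col (e m) (B m) w|%:R < tau * b)%R%:R.
  pose b2 w : R := ((tau * b <= #|cand_edges col (e m) (B m) w|%:R) &&
    (#|cand col non (e m) (B m) w|%:R < tau * b / 4 ^+ size w))%:R.
  (* A valid list of neither exceptional kind has at least [sg * b] extensions; in all other cases
     the bracket is at most 0. *)
  apply: (le_trans (y := tsum (stack B m)
      (fun w => sg * b * ((valid w)%:R - b1 w - b2 w)))); last first.
    apply: tsum_le => w /inside_size; rewrite size_stack => sw.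
    rewrite /b1 /b2 sw; case: (boolP (valid w)) => vw; last first.
      apply: (le_trans (y := 0)); last by rewrite sumr_ge0.
      apply: mulr_ge0_le0 => //.
      by rewrite /= sub0r -opprD oppr_le0 addr_ge0.
    have -> : \sum_(x in B m) (valid (x :: w))%:R =
        #|cand col non (e m) (B m) w|%:R :> R.
      rewrite -sum1_card natr_sum [RHS](eq_bigl (fun x => (x \in B m) &&
        fits col non (e m) x w)); last by move=> x; rewrite inE.
      rewrite [RHS]big_mkcondr /=; apply: eq_bigr => x _.
      by rewrite sw vw andbT; case: fits.
    case: (ltP _ (tau * b)) => _ /=.
      by rewrite subrr sub0r oppr0 mulr0.
    case: ltP => [_|big]; first by rewrite subr0 subrr mulr0.
    rewrite !subr0 mulr1; apply: le_trans big; rewrite /sg mulrAC.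
    apply: ler_wpM2l; first by rewrite mulr_ge0 ?ltW.
    rewrite lef_pV2 ?posrE ?exprn_gt0 //.
    by rewrite ler_weXn2l ?ler1n // ltnW.
  rewrite tsumZ !tsumB /= {1}/volume big_cons -/(volume R (stack B m)) -/b.
  have vol0 := volume_ge0 R (stack B m).
  have t1 : tsum (stack B m) b1 <= (sg / 2) ^+ m / 4 * volume R (stack B m).
    apply: (le_trans (hbad m mn)); rewrite -/b.
    apply: (le_trans (y := (sg / 2) ^+ m * gam ^+ m / 4 * b ^+ m)).
      by rewrite ler_wpM2r ?exprn_ge0 ?hbeta ?ltW.
    have -> : (sg / 2) ^+ m * gam ^+ m / 4 * b ^+ m =
        (sg / 2) ^+ m / 4 * (gam * b) ^+ m by rewrite [(gam * b) ^+ m]exprMn; ring.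
    apply: ler_wpM2l; first exact: divr_ge0.
    apply: volume_stack_ge => [|l lm]; first exact: mulr_ge0 (ltW b0).
    by apply: hgam; rewrite lm.
  have t2 : tsum (stack B m) b2 <= (sg / 2) ^+ m / 4 * volume R (stack B m).
    apply: (le_trans (y := m%:R * kap * volume R (stack B m))); last first.
      by apply: ler_wpM2r => //; apply: hkap.
    rewrite -[in m%:R](size_stack B m); 
    apply: (@few_small_cand R V col non (tau * b) kap m) => //.
    - by move=> A E /mem_stack[l lm ->]; apply: hnon; rewrite lm.
    - by rewrite size_stack.
    - exact: mulr_ge0 (ltW tau0) (ltW b0).
  have -> : (sg / 2) ^+ m.+1 * (b * volume R (stack B m)) =
    sg * b * ((sg / 2) ^+ m * volume R (stack B m) / 2) by rewrite exprS; ring.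
  by apply: ler_wpM2l => //; lra.
have [w wB] : exists2 w, inside (stack B n) w & 0 < (valid w)%:R :> R.
  apply: tsum_exists; rewrite mul0r; apply: lt_le_trans (count n (leqnn n)).
  apply: mulr_gt0; first by apply: exprn_gt0; apply: divr_gt0.
  rewrite /volume big_seq; apply: prodr_gt0.
  by move=> A /mem_stack[l ln ->]; rewrite ltr0n B0.
by rewrite ltr0n lt0b => vw; exists w => //; rewrite (inside_size wB) size_stack.
Qed.

End Embedding.

(** * Consequences of pseudo-randomness *)

Section PseudoRandom.
Variables (R : realType) (V : finType) (G : sgraph V) (p lambda : R).
Hypothesis hG : pseudo_random G p lambda.
Implicit Types A B E : {set V}.

(** Distinctness is built in because a vertex is not adjacent to itself, and embedded vertices must
    not coincide. *)
Definition nonadj (x y : V) := (x != y) && ~~ adj G x y.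

Lemma nonadj_sym : symmetric nonadj.
Proof. by move=> x y; rewrite /nonadj eq_sym adj_sym. Qed.

Lemma card_edges A B :
  #|[set ab in setX A B | adj G ab.1 ab.2]| =
  (\sum_(x in A) #|[set y in B | adj G x y]|)%N.
Proof.
rewrite -sum1_card; under [RHS]eq_bigr => x _ do rewrite -sum1_card.
rewrite pair_big_dep /=; apply: eq_bigl => -[x y].
by rewrite !inE /= andbA.
Qed.

Lemma pseudo_random_self A : A != set0 -> lambda <= p / 2 * #|A|%:R ->
  p / 2 * (#|A|%:R * #|A|%:R) <=
    \sum_(x in A) #|[set y in A | adj G x y]|%:R.
Proof.
move=> A0 hl; have a0 : 0 < #|A|%:R :> R by rewrite ltr0n card_gt0.
have := hG A0 A0; rewrite /density card_edges natr_sum natrM.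
rewrite -expr2 sqrtr_sqr normr_nat ler_norml => /andP[+ _].
set e := \sum_(x in A) _; have : lambda / #|A|%:R <= p / 2.
  by rewrite ler_pdivrMr.
move=> h1 h2; have : p / 2 <= e / #|A|%:R ^+ 2 by lra.
by rewrite ler_pdivlMr ?exprn_gt0.
Qed.

(** A single vertex has density 0 with itself. Combined with the upper bound on [lambda], this
    forces the graph to be large. *)
Lemma pseudo_random_lambda_ge (x : V) : p <= lambda.
Proof.
have x0 : [set x] != set0 by apply/set0Pn; exists x; rewrite inE.
have := hG x0 x0; rewrite /density card_edges cards1 muln1 sqrtr1 !divr1.
rewrite big_set1 (_ : [set y in [set x] | adj G x y] = set0) ?cards0.
  by rewrite sub0r normrN => /(le_trans (ler_norm _)).
by apply/setP => y; rewrite !inE; case: eqP => // ->; rewrite adj_irrefl.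
Qed.

(** Each counted vertex is adjacent to at least [5 / 8] of [E]: the vertex itself may lie in [E], a
    loss of 1 covered by [8 <= #|E|]. The density thus exceeds [p] by at least [1 / 8], which bounds
    the product of the sizes. *)
Lemma few_nonadj A E : p <= 1 / 2 -> 8 <= #|E|%:R :> R ->
  #|[set x in A | #|[set y in E | nonadj y x]|%:R < #|E|%:R / 4 :> R]|%:R
    * #|E|%:R <= 64 * lambda ^+ 2.
Proof.
move=> hp E8; set X := [set x in A | _].
have E0 : E != set0.
  by rewrite -card_gt0 -(ltr0n R); apply: lt_le_trans E8.
have [->|X0] := eqVneq X set0.
  by rewrite cards0 mul0r mulr_ge0 ?sqr_ge0.
have XE0 : 0 < #|X|%:R * #|E|%:R :> R.
  by rewrite mulr_gt0 ?ltr0n ?card_gt0.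
have deg x : x \in X -> 5 / 8 * #|E|%:R <= #|[set y in E | adj G x y]|%:R :> R.
  rewrite inE => /andP[_ few].
  have : (#|E| <= #|[set y in E | adj G x y]| + #|[set y in E | nonadj y x]| + 1)%N.
    rewrite -(cards1 x).
    apply: (leq_trans (subset_leq_card (B := [set y in E | adj G x y] :|:
        [set y in E | nonadj y x] :|: [set x]) _)).
      apply/subsetP => y yE; rewrite !inE yE /= /nonadj adj_sym.
      by case: eqP => _; rewrite ?orbT // orbF /= orbN.
    apply: (leq_trans (leq_card_setU _ _)); rewrite leq_add2r.
    exact: leq_card_setU.
  rewrite -(ler_nat R) !natrD; lra.
have := hG X0 E0; rewrite /density card_edges natr_sum natrM.
set s := Num.sqrt _; have s0 : 0 < s by rewrite sqrtr_gt0.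
have e1 : 5 / 8 <= (\sum_(x in X) #|[set y in E | adj G x y]|%:R) / (#|X|%:R * #|E|%:R) :> R.
  rewrite ler_pdivlMr // mulrCA [leLHS]mulr_natl -sumr_const.
  by apply: ler_sum => x xX; apply: deg.
rewrite ler_norml => /andP[_ h].
have : 1 / 8 <= lambda / s by lra.
rewrite ler_pdivlMr // => h8.
rewrite -(sqr_sqrtr (ltW XE0)) -/s.
have : s <= 8 * lambda by lra.
have : 0 <= s by exact: ltW.
nra.
Qed.

End PseudoRandom.

(** * Iterated steps and the pigeonhole principle on levels *)

Section Levels.
Variables (R : realFieldType) (V C : finType).
Variable step : {set V} -> C -> {set V} -> Prop.

(** The initial size keeps every set to which a step is applied above [mn]. As [L] is positive, the
    first step provides an element of [C] to fill the irrelevant values of [is_]. *)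
Lemma iterate_levels (rho mn : R) : 0 <= rho <= 1 ->
  (forall A : {set V}, mn <= #|A|%:R -> exists i A',
     [/\ step A i A', A' \subset A & rho * #|A|%:R <= #|A'|%:R]) ->
  forall L (A : {set V}), mn <= rho ^+ L * #|A|%:R -> (0 < L)%N ->
  exists (As : nat -> {set V}) (is_ : nat -> C), As 0%N = A /\
    forall s, (s < L)%N -> [/\ step (As s) (is_ s) (As s.+1),
      As s.+1 \subset As s & rho * #|As s|%:R <= #|As s.+1|%:R].
Proof.
move=> /andP[rho0 rho1] hstep; elim=> // L IH A hA _.
have [i [A' [st sub sz]]] : exists i A',
    [/\ step A i A', A' \subset A & rho * #|A|%:R <= #|A'|%:R].
  apply: hstep; apply: (le_trans hA); rewrite -[leRHS]mul1r.
  by rewrite ler_wpM2r // exprn_ile1.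
case: (posnP L) => [->|L0].
  exists (fun s => if s is s'.+1 then A' else A), (fun=> i).
  by split=> // -[].
have [|As [is_ [As0 Ass]]] := IH A' _ L0.
  by apply: (le_trans hA); rewrite exprSr -mulrA ler_wpM2l ?exprn_ge0.
exists (fun s => if s is s'.+1 then As s' else A).
exists (fun s => if s is s'.+1 then is_ s' else i).
split=> // -[_|s sL]; first by rewrite As0.
exact: Ass.
Qed.

Lemma levels_sub (As : nat -> {set V}) L :
  (forall s, (s < L)%N -> As s.+1 \subset As s) ->
  forall s s', (s <= s' <= L)%N -> As s' \subset As s.
Proof.
move=> sub s; elim=> [|s' IH] /andP[ss' s'L].
  by move: ss'; rewrite leqn0 => /eqP ->.
move: ss'; rewrite leq_eqVlt => /predU1P[->//|ss'].
by apply: subset_trans (sub _ s'L) _; apply: IH; rewrite -ltnS ss' ltnW.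
Qed.

Lemma levels_card (As : nat -> {set V}) (rho : R) L : 0 <= rho <= 1 ->
  (forall s, (s < L)%N -> rho * #|As s|%:R <= #|As s.+1|%:R) ->
  forall s s', (s <= s' <= L)%N -> rho ^+ L * #|As s|%:R <= #|As s'|%:R.
Proof.
move=> /andP[rho0 rho1] sz s s' /andP[ss' s'L].
apply: (le_trans (y := rho ^+ (s' - s) * #|As s|%:R)).
  by rewrite ler_wpM2r // ler_wiXn2l // (leq_trans (leq_subr _ _)).
elim: s' ss' s'L => [|s' IH] ss' s'L.
  by move: ss'; rewrite leqn0 => /eqP ->; rewrite mul1r.
move: ss'; rewrite leq_eqVlt => /predU1P[->|ss']; first by rewrite subnn mul1r.
rewrite subSn // exprS -mulrA; apply: le_trans (sz _ s'L).
by rewrite ler_wpM2l // IH // ltnW.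
Qed.

Lemma popular_value (f : nat -> C) n : (0 < #|C|)%N ->
  exists i (lev : nat -> nat),
    (forall m, (m < n)%N -> (lev m < #|C| * n)%N /\ f (lev m) = i) /\
    (forall l m, (l < m < n)%N -> (lev m < lev l)%N).
Proof.
move=> C0; set L := (#|C| * n)%N.
pose fib i := [seq s <- iota 0 L | f s == i].
have [i hi] : exists i, (n <= size (fib i))%N.
  case: (pickP (fun i => (n <= size (fib i))%N)) => [i ?|none]; first by exists i.
  case: (posnP n) => [n0|n0].
    by case/card_gt0P: C0 => i _; exists i; rewrite n0.
  have: (\sum_(i : C) size (fib i) <= \sum_(i : C) n.-1)%N.
    by apply: leq_sum => i _; have := none i; rewrite leqNgt; case: ltnP => // h _; rewrite -ltnS prednK.
  rewrite sum_nat_const.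
  have -> : (\sum_(i : C) size (fib i) = L)%N.
    rewrite -[RHS](size_iota 0) /fib.
    elim: (iota 0 L) => [|s r IH] /=; first by rewrite big1.
    rewrite -IH -(addn0 (\sum_i _)%N) (bigD1 (f s)) //= eqxx /=.
    rewrite [in RHS](bigD1 (f s)) //= addn0 addSn; congr (_ + _).+1.
    by apply: eq_bigr => j /negPf; rewrite eq_sym => ->.
  by rewrite leq_pmul2l // leqNgt ltn_predL n0.
(* The increasing list of levels of value [i] is read from its end, so that the deepest level comes
   first. *)
exists i, (fun m => nth 0%N (fib i) (size (fib i) - m.+1)); split.
  move=> m mn; have : nth 0%N (fib i) (size (fib i) - m.+1) \in fib i.
    by rewrite mem_nth // ltn_subrL /=; apply: leq_trans hi; apply: leq_ltn_trans mn.
  by rewrite mem_filter mem_iota => /andP[/eqP -> /andP[_]].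
move=> l m /andP[lm mn]; apply: (sorted_ltn_nth ltn_trans); rewrite ?inE; try lia.
by apply: sorted_filter; [exact: ltn_trans | exact: iota_ltn_sorted].
Qed.

End Levels.

(** * Inequalities between powers of [z] *)

Section Constants.
Variables (R : realFieldType) (z : R).
Hypotheses (z0 : 0 < z) (z4 : z <= 1 / 4).

Lemma pow_le a b : (b <= a)%N -> z ^+ a <= z ^+ b.
Proof.
move=> ba; apply: ler_wiXn2l => //; first exact: ltW.
by apply: le_trans z4 _; rewrite ler_pdivrMr // mul1r ler1n.
Qed.

Lemma pow_le_inv4 n : z ^+ n <= (4 ^+ n)^-1.
Proof.
rewrite -exprVn; apply: lerXn2r; rewrite ?nnegrE ?invr_ge0 ?(ltW z0) //.
by rewrite -div1r.
Qed.

Lemma natr_pow_le1 n : 2 * n%:R * z ^+ n <= 1.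
Proof.
apply: (le_trans (y := 4 ^+ n * (4 ^+ n)^-1)).
  apply: ler_pM; rewrite ?mulr_ge0 ?exprn_ge0 ?pow_le_inv4 ?(ltW z0) //.
  rewrite -natrM -natrX ler_nat; elim: n => // n; rewrite expnS; lia.
by rewrite mulfV // expf_neq0 // pnatr_eq0.
Qed.

Lemma base_le a n : z ^+ (a + n + 1) <= z ^+ a / 4 ^+ n / 2.
Proof.
rewrite !exprD expr1.
apply: ler_pM; rewrite ?mulr_ge0 ?exprn_ge0 ?(ltW z0) //; last by have := z4; lra.
by apply: ler_wpM2l; rewrite ?exprn_ge0 ?(ltW z0) // pow_le_inv4.
Qed.

(** The exponent [14 * P * n] on the left exceeds the one on the right by at least [n] when [n] is
    positive, and [z ^+ n] absorbs the factor [2 * n]. *)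
Lemma beta_choice P n : (n + 7 <= 2 * P)%N ->
  2 * n%:R * (z ^+ (7 * P)) ^+ (2 * n) <=
  z ^+ (n * (12 * P + n + 1) + 1) * (z ^+ 2) ^+ (2 * n).
Proof.
case: (posnP n) => [-> _|n0 hP].
  by rewrite mulr0 mul0r mulr_ge0 ?exprn_ge0 ?(ltW z0).
rewrite -!exprM -exprD.
apply: (le_trans (y := 2 * n%:R * (z ^+ n * z ^+ (n * (12 * P + n + 1) + 1 + 2 * (2 * n))))).
  apply: ler_wpM2l; first by rewrite mulr_ge0.
  by rewrite -exprD; apply: pow_le; nia.
rewrite mulrA -[leRHS]mul1r ler_wpM2r ?exprn_ge0 ?(ltW z0) //.
exact: natr_pow_le1.
Qed.

(** Per factor, [12 * P + n + 1] pays [7 * P] for the threshold, [5 * P] for the size ratio, [n] for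
    [4 ^+ n] and 1 for the 2; the last [+ 1] pays for the 4. *)
Lemma beta_small P n m : (m < n)%N ->
  z ^+ (n * (12 * P + n + 1) + 1) <=
  (z ^+ (7 * P) / 4 ^+ n / 2) ^+ m * (z ^+ (5 * P)) ^+ m / 4.
Proof.
move=> mn; apply: (le_trans (y := (z ^+ (7 * P + n + 1)) ^+ m * (z ^+ (5 * P)) ^+ m * z)).
  by rewrite -!exprM -exprD -exprSr; apply: pow_le; nia.
apply: ler_pM; rewrite ?mulr_ge0 ?exprn_ge0 ?(ltW z0) //; last by have := z4; lra.
apply: ler_wpM2r; first by rewrite !exprn_ge0 ?(ltW z0).
by apply: lerXn2r; rewrite ?nnegrE ?base_le ?divr_ge0 ?exprn_ge0 ?(ltW z0).
Qed.

Lemma kap_small P n m : (m < n)%N ->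
  m%:R * z ^+ (n * (7 * P + n + 2) + 1) <=
  (z ^+ (7 * P) / 4 ^+ n / 2) ^+ m / 4.
Proof.
move=> mn; apply: (le_trans (y := (z ^+ (7 * P + n + 1)) ^+ m * z)); last first.
  apply: ler_pM; rewrite ?exprn_ge0 ?(ltW z0) //; last by have := z4; lra.
  by apply: lerXn2r; rewrite ?nnegrE ?base_le ?divr_ge0 ?exprn_ge0 ?(ltW z0).
rewrite -exprM -exprSr.
apply: (le_trans (y := 2 * n%:R * z ^+ n * z ^+ ((7 * P + n + 1) * m).+1)); last first.
  rewrite -[leRHS]mul1r ler_wpM2r ?exprn_ge0 ?(ltW z0) //.
  exact: natr_pow_le1.
rewrite -mulrA -exprD; apply: ler_pM; rewrite ?exprn_ge0 ?(ltW z0) //.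
  by rewrite -natrM ler_nat; lia.
by apply: pow_le; nia.
Qed.

End Constants.

(** For [P = k * n * n], [M] is the exponent in the bound on [lambda]. The three inequalities serve
    the density of each level, the size of the candidate sets and the number of spoiling vertices,
    in this order. *)
Lemma exponent_bounds n P (M := (100 * (n * P))%N) : (2 <= n <= P)%N ->
  [/\ (5 * P < M)%N, (12 * P + n + 3 <= M)%N &
    (n * (7 * P + n + 2) + 1 + 5 * P + (12 * P + n) + 3 <= M * 2)%N].
Proof.
move=> /andP[n2 nP]; rewrite /M.
have h1 : (2 * P <= n * P)%N by rewrite leq_mul2r n2 orbT.
have h2 : (n * n <= n * P)%N by rewrite leq_mul2l nP orbT.
have -> : (n * (7 * P + n + 2) = 7 * (n * P) + n * n + 2 * n)%N by ring.
by move: (n * n)%N (n * P)%N h1 h2 => a b; split; lia.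
Qed.

(** * Choice of parameters and an embedding in one colour *)

Section MonochromaticInduced.
Variables (R : realType) (n k : nat) (V : finType) (G : sgraph V).
Variables (p lambda : R) (c : {set V} -> 'I_k).

Definition coladj (i : 'I_k) (x y : V) := adj G x y && (c [set x; y] == i).

Lemma coladj_sym i : symmetric (coladj i).
Proof. by move=> x y; rewrite /coladj adj_sym setUC. Qed.

Lemma sum_coladj (A : {set V}) :
  \sum_(i < k) \sum_(x in A) #|[set y in A | coladj i x y]|%:R =
  \sum_(x in A) #|[set y in A | adj G x y]|%:R :> R.
Proof.
rewrite exchange_big; apply: eq_bigr => x _; rewrite -natr_sum; congr (_ %:R).
under eq_bigr do rewrite -sum1_card; rewrite -sum1_card.
rewrite (partition_big (fun y => c [set x; y]) xpredT) //=.
by apply: eq_bigr => i _; apply: eq_bigl => y; rewrite !inE /coladj andbA.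
Qed.

(** Every colour has its own pattern [e i], and the colour found realises its own one; this freedom
    later gives one colour for all graphs. *)
Lemma exists_valid (e : 'I_k -> nat -> nat -> bool) :
  (2 <= n)%N -> (2 <= k)%N -> (0 < #|V|)%N -> 0 < p -> p <= 1 / 2 ->
  pseudo_random G p lambda ->
  lambda <= (k%:R / p) ^- (100 * n ^ 3 * k)%N * #|V|%:R ->
  exists i, exists2 w, size w = n & valid (coladj i) (nonadj G) (e i) w.
Proof.
move=> n2 k2 V0 p0 p12 hG.
set z := p / k%:R; have k0 : 0 < k%:R :> R by rewrite ltr0n; lia.
have z0 : 0 < z by rewrite divr_gt0.
have k2R : 2 <= k%:R :> R by rewrite ler_nat.
have z4 : z <= 1 / 4 by rewrite ler_pdivrMr //; lra.
have zp : 2 * z <= p.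
  by rewrite /z mulrCA -[leRHS]mulr1 ler_pM2l // ler_pdivrMr // mul1r.
pose P := (k * n * n)%N.
have [N hN] : {N : R | N = #|V|%:R} by exists #|V|%:R.
rewrite -hN; have N0 : 0 < N by rewrite hN ltr0n.
have nP : (n + 7 <= 2 * P)%N by rewrite /P; nia.
have n_le_P : (n <= P)%N by rewrite /P; nia.
have PL : (5 * n * (k * n) = 5 * P)%N by rewrite /P; lia.
(* [M], [N] and the parameters below are kept opaque: conversion would unfold
   their large exponents. *)
have [M hM] : {M | M = 100 * (n * P)}%N by exists (100 * (n * P))%N.
have -> : (k%:R / p) ^- (100 * n ^ 3 * k)%N = z ^+ M.
  rewrite -exprVn invf_div; congr (_ ^+ _); rewrite hM /P !expnS expn0; lia.
have kz : k%:R * z = p by rewrite /z mulrC divfK ?gt_eqF.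
have [M1 M2 M3] := @exponent_bounds n P (introT andP (conj n2 n_le_P)).
rewrite -hM in M1 M2 M3; clearbody P z => hl.
have lam_p : p <= lambda.
  by case/card_gt0P: V0 => x _; apply: (pseudo_random_lambda_ge hG x).
(* [mn] bounds all levels from below, [tau] marks small candidate sets, [q] is half the density
   required of a colour, [beta] and [kap] are the tolerated shares of exceptional tuples and
   spoiling vertices, and [rho] is the shrinkage per level. *)
have [mn mnE] : {x : R | x = z ^+ (5 * P) * N} by eexists.
have [tau tauE] : {x : R | x = z ^+ (7 * P)} by eexists.
have [q qE] : {x : R | x = z ^+ 2} by eexists.
have [beta betaE] : {x : R | x = z ^+ (n * (12 * P + n + 1) + 1)} by eexists.
have [kap kapE] : {x : R | x = z ^+ (n * (7 * P + n + 2) + 1)} by eexists.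
have mn0 : 0 < mn by rewrite mnE mulr_gt0 ?exprn_gt0.
have [rho rhoE] : {x : R | x = z ^+ (5 * n)} by eexists.
pose L := (k * n)%N.
have rhoL : rho ^+ L = z ^+ (5 * P) by rewrite rhoE -exprM PL.
have rho01 : 0 <= rho <= 1.
  rewrite rhoE exprn_ge0 ?(ltW z0) //= exprn_ile1 ?(ltW z0) //; lra.
pose step (A : {set V}) (i : 'I_k) (A' : {set V}) := forall m, (m < n)%N ->
  tsum (nseq m A') (fun w =>
    (#|cand_edges (coladj i) (e i m) A w|%:R < tau * #|A|%:R)%R%:R)
      <= beta * #|A|%:R ^+ m.
have hstep (A : {set V}) : mn <= #|A|%:R -> exists i A',
    [/\ step A i A', A' \subset A & rho * #|A|%:R <= #|A'|%:R].
  move=> hA; have a0 : 0 < #|A|%:R :> R by apply: lt_le_trans hA.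
  have A0 : (0 < #|A|)%N by rewrite -(ltr0n R).
  have lamA : lambda <= p / 2 * #|A|%:R.
    apply: (le_trans hl); apply: (le_trans (y := z * mn)).
      have -> : z * mn = z ^+ (5 * P).+1 * N by rewrite mnE exprS mulrA.
      by apply: ler_wpM2r; [exact: ltW | exact: pow_le].
    apply: ler_pM => //; [exact: ltW | exact: ltW | lra].
  have [|||||||i [A' [sub sz bad]]] := @dependent_random_choice R V k coladj A
      q tau beta n (2 * n) e coladj_sym A0 _ _ _ _ _ _ _.
  - exact: ltnW.
  - by rewrite muln_gt0 /= (ltnW n2).
  - by rewrite qE exprn_gt0.
  - by rewrite tauE exprn_ge0 ?(ltW z0).
  - by rewrite betaE exprn_gt0.
  - by rewrite tauE betaE qE; apply: beta_choice.
  - rewrite sum_coladj.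
    apply: le_trans (pseudo_random_self hG _ lamA); last by rewrite -card_gt0.
    have -> : k%:R * (2 * q * #|A|%:R * #|A|%:R) =
      2 * (k%:R * z * z) * (#|A|%:R * #|A|%:R) by rewrite qE; ring.
    rewrite kz.
    by apply: ler_wpM2r; [rewrite mulr_ge0 | nra].
  exists i, A'; split=> //; apply: le_trans sz; apply: ler_wpM2r => //.
  (* The power of [q] is [z ^+ (4 * n)] and the division by 4 costs one more [z], within the [5 * n]
     allowed by [rho]. *)
  rewrite rhoE qE -exprM; apply: (le_trans (y := z ^+ (2 * (2 * n)) * z)).
    by rewrite -exprSr; apply: pow_le => //; clear -n2; lia.
  by apply: ler_wpM2l; [rewrite exprn_ge0 ?(ltW z0) | lra].
have L0 : (0 < L)%N by rewrite muln_gt0 (ltnW k2) (ltnW n2).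
have [|As [is_ [As0 hAs]]] := iterate_levels rho01 hstep (A := setT) _ L0.
  by rewrite rhoL cardsT -hN mnE.
have Asub := levels_sub (fun s sL => let: And3 _ h _ := hAs s sL in h).
have Acard := levels_card rho01 (fun s sL => let: And3 _ _ h := hAs s sL in h).
rewrite rhoL in Acard.
have [|i [lev [hlev lev_lt]]] := @popular_value 'I_k is_ n.
  by rewrite card_ord (ltnW k2).
rewrite card_ord -/L in hlev.
pose B m := As (lev m).
have Bmn m : (m < n)%N -> mn <= #|B m|%:R.
  move=> /hlev[levL _]; rewrite mnE hN -cardsT -As0; apply: Acard.
  exact: ltnW.
have B0 m : (m < n)%N -> (0 < #|B m|)%N.
  by move=> mn'; rewrite -(ltr0n R); apply: lt_le_trans mn0 (Bmn m mn').
exists i; apply: (@valid_exists R V (coladj i) (nonadj G) (e i) B n tau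
  (z ^+ (5 * P)) beta kap) => //.
- by rewrite tauE exprn_gt0.
- by rewrite exprn_ge0 ?(ltW z0).
- by rewrite kapE exprn_ge0 ?(ltW z0).
- move=> l m /andP[lm mn']; apply: Acard.
  rewrite ltnW ?lev_lt ?lm //= ltnW //.
  by have [] := hlev l (ltn_trans lm mn').
- move=> m mn'; have [levL levi] := hlev m mn'.
  have [st _ _] := hAs _ levL; have := st m mn'; rewrite levi.
  apply: le_trans; apply: tsum_subset => [w|]; first exact: ler0n.
  (* Earlier embedded vertices come from deeper levels, hence from the set selected at level
     [lev m], where exceptional tuples are few. *)
  have subB l : (l < m)%N -> B l \subset As (lev m).+1.
    move=> lm; apply: Asub; rewrite lev_lt ?lm //= ltnW //.
    by have [] := hlev l (ltn_trans lm mn').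
  suff all2B j : (j <= m)%N -> all2 (fun A B : {set V} => A \subset B)
    (stack B j) (nseq j (As (lev m).+1)) by apply: all2B.
  by elim: j => //= j IH jm; rewrite subB //= IH // ltnW.
- move=> l m E /andP[lm mn'] hE.
  have hE' : z ^+ (12 * P + n) * N <= #|E|%:R.
    apply: le_trans hE.
    apply: (le_trans (y := tau * mn * z ^+ n)).
      rewrite tauE mnE -[12%N]/(7 + 5)%N mulnDl !exprD le_eqVlt.
      by apply/orP; left; apply/eqP; ring.
    have tau0 : 0 <= tau by rewrite tauE exprn_ge0 ?(ltW z0).
    apply: ler_pM; rewrite ?mulr_ge0 ?exprn_ge0 ?(ltW z0) ?(ltW mn0) //.
      by apply: ler_wpM2l => //; apply: Bmn.
    apply: le_trans (pow_le_inv4 z0 z4 m); apply: pow_le => //; exact: ltnW.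
  have zM : z <= z ^+ M * N by lra.
  have big : 8 <= z ^+ (12 * P + n) * N.
    have : z ^+ 3 * (z ^+ (12 * P + n) * N) >= z.
      apply: (le_trans zM); rewrite mulrA -exprD; apply: ler_wpM2r; first exact: ltW.
      by apply: pow_le => //; rewrite addnC.
    set y := _ * N; move=> h.
    have z3 : 0 < z ^+ 3 by rewrite exprn_gt0.
    rewrite -(ler_pM2l z3); apply: le_trans h.
    rewrite exprS -[leRHS]mulr1 -mulrA ler_pM2l //; nra.
  have E8 : 8 <= #|E|%:R :> R by apply: le_trans hE'.
  have few := few_nonadj hG (B l) p12 E8.
  set X : R := #|_|%:R in few *.
  have X0 : 0 <= X by exact: ler0n.
  have c0 : 0 < z ^+ (12 * P + n) * N by rewrite mulr_gt0 ?exprn_gt0.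
  rewrite -(ler_pM2r c0); apply: (le_trans (y := X * #|E|%:R)).
    by apply: ler_wpM2l.
  apply: (le_trans few).
  apply: (le_trans (y := 64 * (z ^+ M * N) ^+ 2)).
    by apply: ler_wpM2l => //; apply: lerXn2r; rewrite ?nnegrE ?(le_trans _ lam_p) ?mulr_ge0 ?exprn_ge0 ?(ltW z0) ?(ltW p0) ?(ltW N0).
  apply: (le_trans (y := kap * mn * (z ^+ (12 * P + n) * N))); last first.
    apply: ler_wpM2r; first exact: ltW.
    apply: ler_wpM2l; first by rewrite kapE exprn_ge0 ?(ltW z0).
    by apply: Bmn; apply: ltn_trans mn'.
  have -> : kap * mn * (z ^+ (12 * P + n) * N) =
      z ^+ (n * (7 * P + n + 2) + 1 + 5 * P + (12 * P + n)) * N ^+ 2.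
    by rewrite kapE mnE !exprD; ring.
  rewrite exprMn mulrA; apply: ler_wpM2r; first exact: exprn_ge0 (ltW N0).
  (* The factor 64 is [4 ^+ 3], at most the inverse of [z ^+ 3]; hence the summand 3 in [M3]. *)
  rewrite -exprM; apply: (le_trans (y := (z ^+ 3)^-1 * z ^+ (M * 2))).
    apply: ler_wpM2r; first by rewrite exprn_ge0 ?(ltW z0).
    have := pow_le_inv4 z0 z4 3; rewrite -[X in _ <= X -> _]mul1r.
    rewrite ler_pdivlMr ?exprn_gt0 // => h.
    rewrite -[leRHS]mul1r ler_pdivlMr ?exprn_gt0 //; apply: le_trans h; lra.
  rewrite ler_pdivrMl ?exprn_gt0 // -exprD; apply: pow_le => //.
  by rewrite addnC.
- by move=> m mn'; rewrite tauE betaE; apply: beta_small.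
- by move=> m mn'; rewrite tauE kapE; apply: kap_small.
Qed.

End MonochromaticInduced.

(** * From vertex lists to induced copies, and a colour common to all graphs *)

Lemma valid_nth (V : finType) (col non : rel V) e x0 w :
  valid col non e w -> forall j l, (j < l < size w)%N ->
  if e l j then col (nth x0 (rev w) l) (nth x0 (rev w) j)
  else non (nth x0 (rev w) l) (nth x0 (rev w) j).
Proof.
(* Lists have the latest vertex first, so in [rev w] a new head becomes the last entry. If [l] is
   that entry, a second induction locates [j] in the tail. *)
elim: w => [|x w IH] /=; first by move=> _ j l; rewrite ltn0 andbF.
move=> /andP[fx vw] j l /andP[jl]; rewrite ltnS leq_eqVlt rev_cons.
case/predU1P => [lw|lw]; last first.
  by rewrite !nth_rcons !size_rev lw (ltn_trans jl lw); apply: IH; rewrite ?jl.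
rewrite !nth_rcons !size_rev lw -lw jl lw ltnn eqxx.
move: jl; rewrite lw {IH vw lw l}; move: (e (size w)) fx => row.
elim: w => //= y w IH /andP[fy fw]; rewrite ltnS leq_eqVlt rev_cons.
case/predU1P => [->|jw]; rewrite nth_rcons size_rev ?ltnn ?eqxx //.
by rewrite jw; apply: IH.
Qed.

Section Copies.
Variables (R : realType) (n k : nat) (V : finType) (G : sgraph V).
Variables (p lambda : R) (c : {set V} -> 'I_k).

(** Graphs are encoded by finite functions, so that a colour missing some graph can be detected by a
    decidable search. *)
Definition has_copy (i : 'I_k) (E : {ffun 'I_n * 'I_n -> bool}) :=
  [exists v : {ffun 'I_n -> V}, forall x, forall y, (x != y) ==>
     if E (x, y) then coladj G c i (v x) (v y) else nonadj G (v x) (v y)].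

Lemma has_copy_mono (i : 'I_k) :
  (forall E : {ffun 'I_n * 'I_n -> bool},
     (forall x y, E (x, y) = E (y, x)) -> has_copy i E) ->
  forall (U : finType) (F : sgraph U), #|U| = n -> mono_induced_copy F G c i.
Proof.
move=> copies U F Un.
pose g (u : U) : 'I_n := cast_ord Un (enum_rank u).
pose h (x : 'I_n) : U := enum_val (cast_ord (esym Un) x).
have gK : cancel g h by move=> u; rewrite /g /h cast_ordK enum_rankK.
pose E := [ffun xy : 'I_n * 'I_n => adj F (h xy.1) (h xy.2)].
have [|v vE] := existsP (copies E _).
  by move=> x y; rewrite !ffunE adj_sym.
have {}vE x y : x != y -> if adj F (h x) (h y)
    then coladj G c i (v x) (v y) else nonadj G (v x) (v y).
  by move=> xy; have /forallP/(_ y) := forallP vE x; rewrite xy ffunE.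
(* Both [coladj] and [nonadj] fail on equal vertices. *)
have v_inj : injective v.
  move=> x y vxy; apply/eqP; apply: contraT => /vE; rewrite vxy.
  by rewrite /coladj /nonadj adj_irrefl eqxx; case: ifP.
have adjE x y : adj G (v x) (v y) = adj F (h x) (h y).
  have [->|/vE] := eqVneq x y; first by rewrite !adj_irrefl.
  by case: ifP => _; [case/andP | case/andP=> _ /negbTE].
exists [set v x | x : 'I_n]; split.
  have vS u : v (g u) \in [set v x | x : 'I_n] by apply: imset_f.
  exists (fun u => Sub (v (g u)) (vS u)); last first.
    by move=> x y; rewrite /= /induced_adj /= adjE !gK.
  apply: inj_card_bij => [x y /(congr1 val) /= /v_inj /(can_inj gK) //|].
  by rewrite card_sig Un (card_imset _ v_inj) card_ord.
move=> _ _ /imsetP[x _ ->] /imsetP[y _ ->].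
have [->|/vE] := eqVneq x y; first by rewrite adj_irrefl.
rewrite adjE => + Fxy; rewrite Fxy.
by case/andP=> _ /eqP.
Qed.

(** If every colour [i] missed some graph [E i], prescribing all these graphs at once in
    [exists_valid] would produce one of them in its own colour. *)
Lemma exists_universal_colour :
  (2 <= n)%N -> (2 <= k)%N -> (0 < #|V|)%N -> 0 < p -> p <= 1 / 2 ->
  pseudo_random G p lambda ->
  lambda <= (k%:R / p) ^- (100 * n ^ 3 * k)%N * #|V|%:R ->
  exists i, forall E : {ffun 'I_n * 'I_n -> bool},
    (forall x y, E (x, y) = E (y, x)) -> has_copy i E.
Proof.
move=> n2 k2 V0 p0 p12 hG hl.
pose symb (E : {ffun 'I_n * 'I_n -> bool}) :=
  [forall x, forall y, E (x, y) == E (y, x)].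
case: (pickP (fun i => [forall E, symb E ==> has_copy i E])) => [i hi|none].
  exists i => E Esym; have := forallP hi E; suff -> : symb E by [].
  by apply/forallP => x; apply/forallP => y; apply/eqP.
have /fin_all_exists[E hE] i : exists E, symb E && ~~ has_copy i E.
  have := none i => /negbT; rewrite negb_forall => /existsP[E].
  by rewrite negb_imply => hE; exists E.
(* The extension of [E i] to all natural numbers, false outside the range. *)
pose e i l j := [exists x : 'I_n, exists y : 'I_n,
  [&& x == l :> nat, y == j :> nat & E i (x, y)]].
have eE i (x y : 'I_n) : e i x y = E i (x, y).
  apply/existsP/idP => [[x' /existsP[y' /and3P[/eqP xx /eqP yy]]]|Exy].
    by rewrite (val_inj xx) (val_inj yy).
  by exists x; apply/existsP; exists y; rewrite !eqxx.
have [i [w sw vw]] := exists_valid c e n2 k2 V0 p0 p12 hG hl.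
have [x0 _] := card_gt0P V0.
case/andP: (hE i) => Esym /negP[]; apply/existsP.
exists [ffun x : 'I_n => nth x0 (rev w) x].
have low (x y : 'I_n) : (x < y)%N -> if E i (y, x)
    then coladj G c i (nth x0 (rev w) y) (nth x0 (rev w) x)
    else nonadj G (nth x0 (rev w) y) (nth x0 (rev w) x).
  by move=> xy; rewrite -eE; apply: valid_nth vw _ _ _; rewrite xy sw ltn_ord.
apply/forallP => x; apply/forallP => y; apply/implyP; rewrite !ffunE.
rewrite -val_eqE neq_ltn => /orP[xy|yx]; last exact: low.
have /forallP/(_ y)/eqP -> := forallP Esym x.
by have := low _ _ xy; rewrite coladj_sym nonadj_sym.
Qed.

End Copies.

Theorem theorem10p1 (R : realType) (n k : nat) (hn : (2 <= n)%N)
    (hk : (2 <= k)%N) (V : finType) (hV : (0 < #|V|)%N) (Gamma : sgraph V)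
    (p lambda : R) (hp0 : 0 < p) (hp : p <= 1 / 2)
    (hGamma : pseudo_random Gamma p lambda)
    (hlambda : lambda <= (k%:R / p) ^- (100 * n ^ 3 * k)%N * #|V|%:R)
    (c : {set V} -> 'I_k) :
  (forall (U : finType) (F : sgraph U), #|U| = n ->
     exists i : 'I_k, mono_induced_copy F Gamma c i) /\
  (exists i : 'I_k, forall (U : finType) (F : sgraph U), #|U| = n ->
     mono_induced_copy F Gamma c i).
Proof.
have [i hi] := exists_universal_colour c hn hk hV hp0 hp hGamma hlambda.
by split=> [U F Un|]; exists i => *; apply: has_copy_mono hi _ _ _.
Qed.
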